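(* Let $0<\beta<1$ and $p=\lceil\beta^{-1}\rceil-1$. Let $G$ be a $K_{p+2}$-free graph of order $n$ with minimum degree $(1-\beta)n$ (where $(1-\beta)n$ is an integer). Then $$\frac{k_s(G)}{g_s(\beta)n^s}\ge\frac{k_t(G)}{g_t(\beta)n^t}$$ for all integers $2\le t<s\le p+1$. Moreover, the following are equivalent: (i) equality holds for some $2\le t<s\le p+1$; (ii) equality holds for all $2\le t<s\le p+1$; (iii) $(n,\beta)$ is feasible and $G\in\mathcal{G}(n,\beta)$.
   Context: All graphs are finite and simple; $k_r(G)$ is the number of $r$-cliques of $G$. For $0<\beta<1$, $p=\lceil\beta^{-1}\rceil-1$ and integers $r$, define $$g_r(\beta)=\binom{p-1}{r}\beta^{r}+\binom{p-1}{r-1}(1-(p-1)\beta)\beta^{r-1}+\frac12\binom{p-1}{r-2}(1-p\beta)(1-(p-1)\beta)\beta^{r-2},$$ where $\binom{x}{y}=0$ if $x<y$ or $y<0$. The family $\mathcal{G}(n,\beta)$ (defined only when $n$ and $(1-\beta)n$ are positive integers not both odd) consists of all graphs $G$ on vertex set $V$, $|V|=n$, admitting a partition $V=V_0\cup V_1\cup\dots\cup V_{p-1}$ with $|V_0|=(1-(p-1)\beta)n$ and $|V_i|=\beta n$ for $1\le i\le p-1$, such that: all edges between $V_i$ and $V_j$ are present for $0\le i<j\le p-1$; $V_i$ is independent for $1\le i\le p-1$; and $G[V_0]$ is $(1-p\beta)n$-regular with minimum number of triangles among all $(1-p\beta)n$-regular graphs on $|V_0|$ vertices. The pair $(n,\beta)$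 is feasible if $\mathcal{G}(n,\beta)$ is defined and $G[V_0]$ is triangle-free for $G\in\mathcal{G}(n,\beta)$.
   Formalization: The equivalence of (i), (ii), (iii) is stated only for p ≥ 2: for p = 1 there are no 2 ≤ t < s ≤ p+1, so (i) is false while (ii) holds vacuously (e.g. the 4-cycle with β = 1/2). β is taken rational, which integrality of (1-β)n forces. *)

(* Defs.v *)
From HB Require Import structures.
From mathcomp Require Import all_boot all_order all_algebra.
Set Implicit Arguments. Unset Strict Implicit. Unset Printing Implicit Defensive.
Import Order.TTheory GRing.Theory Num.Theory.

Definition simple_graph (T : finType) (e : rel T) : Prop :=
  irreflexive e /\ symmetric e.

Definition is_clique (T : finType) (e : rel T) (A : {set T}) : bool :=
  [forall x in A, forall y in A, (x != y) ==> e x y].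

Definition kcl (T : finType) (r : nat) (e : rel T) : nat :=
  #|[set A : {set T} | (#|A| == r) && is_clique e A]|.

Definition vdeg (T : finType) (e : rel T) (v : T) : nat := #|[set u | e v u]|.

Definition induced (T : finType) (e : rel T) (S : {set T}) : rel T :=
  fun x y => [&& x \in S, y \in S & e x y].

Local Open Scope ring_scope.

(* p = ceil(1/beta) - 1 (a natural number for 0 < beta < 1) *)
Definition pp (beta : rat) : nat := `|Num.ceil (beta^-1) - 1|%N.

Definition binz (x y : int) : rat :=
  if (0 <= y) && (y <= x) then ('C(`|x|%N, `|y|%N))%:R else 0.

Definition gfun (r : nat) (beta : rat) : rat :=
  let p := (pp beta)%:Z in
  binz (p - 1) r%:Z * beta ^+ r
  + binz (p - 1) (r%:Z - 1) * (1 - (p - 1)%:~R * beta) * beta ^+ r.-1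
  + 2^-1 * binz (p - 1) (r%:Z - 2) * (1 - p%:~R * beta)
       * (1 - (p - 1)%:~R * beta) * beta ^+ r.-2.

Definition family_defined (n : nat) (beta : rat) : Prop :=
  (0 < n)%N /\ exists k : nat, (0 < k)%N /\ k%:R = (1 - beta) * n%:R
                                /\ ~~ (odd n && odd k).

(* The partition V_0, ..., V_{p-1} is given by f : T -> 'I_p, V_i = f^-1(i). *)
Definition part0 (T : finType) (p : nat) (f : T -> 'I_p) : {set T} :=
  [set v | (f v : nat) == 0%N].

Definition family_part (T : finType) (e : rel T) (beta : rat)
    (f : T -> 'I_(pp beta)) : Prop :=
  let p := pp beta in
  let n := #|T| in
  let V0 := part0 f in
  simple_graph e /\
  #|V0|%:R = (1 - (p.-1)%:R * beta) * n%:R /\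
  (forall i : 'I_p, (0 < i)%N -> #|[set v | f v == i]|%:R = beta * n%:R) /\
  (forall u v, f u != f v -> e u v) /\
  (forall u v, (0 < f u)%N -> f u = f v -> ~~ e u v) /\
  (forall v, v \in V0 -> #|[set u in V0 | e v u]|%:R = (1 - p%:R * beta) * n%:R) /\
  (forall e' : rel 'I_#|V0|, simple_graph e' ->
     (forall v, (vdeg e' v)%:R = (1 - p%:R * beta) * n%:R) ->
     (kcl 3 (induced e V0) <= kcl 3 e')%N).

Arguments family_part {T} e beta f.

Definition in_family (T : finType) (e : rel T) (beta : rat) : Prop :=
  family_defined #|T| beta /\ exists f, family_part e beta f.

Definition feasible (n : nat) (beta : rat) : Prop :=
  family_defined n beta /\
  forall (e' : rel 'I_n) (f : 'I_n -> 'I_(pp beta)),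
    family_part e' beta f -> kcl 3 (induced e' (part0 f)) = 0%N.

Definition clq_ratio (T : finType) (e : rel T) (beta : rat) (r : nat) : rat :=
  (kcl r e)%:R / (gfun r beta * (#|T|%:R) ^+ r).

(* Main.v *)
(** For a clique [A] let [d(A)] be the number of its common neighbours. If
    [|A| = t], the minimum degree gives [d(A) >= (1 - t beta) n], and freeness
    from [K_{p+2}] gives [d(A) <= (p + 1 - t) beta n], so
      [(d(A) - (1 - t beta) n) ((p + 1 - t) beta n - d(A)) >= 0]     [(spread)].
    For a [(t+1)]-clique [S], counting the vertices according to the number of
    their non-neighbours in [S] gives
      [sum_{x in S} d(S - x) >= (2 - (t+1) beta) n + (t-1) d(S)]     [(loss)].
    Summing over all cliques and counting pairs [(S, x)] twice eliminates
    [sum d(A)^2] and leaves a linear inequality between [k_t], [k_{t+1}] and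
    [k_{t+2}] which the numbers [g_t(beta) n^t] satisfy with equality. As
    [k_{p+2} = g_{p+2} = 0], it shows by downward induction on [t] that
    [k_t / (g_t n^t)] increases with [t]. Equality anywhere forces equality at
    [t = p]; then [p - 1] facets of any [(p+1)]-clique have degree exactly
    [beta n], and their common neighbourhoods are [V_1, ..., V_{p-1}]. *)
Require Import Defs.
From HB Require Import structures.
From mathcomp Require Import all_boot all_order all_algebra.
From mathcomp Require Import ring lra zify.
Import Order.TTheory GRing.Theory Num.Theory.
Set Implicit Arguments.
Unset Strict Implicit.
Unset Printing Implicit Defensive.
Local Open Scope ring_scope.

(** * The integer [p] and the numbers [g_t(beta)] *)

Lemma pp_bounds (beta : rat) : 0 < beta -> beta < 1 ->
  [/\ (0 < pp beta)%N, (pp beta)%:R * beta < 1 & 1 <= ((pp beta)%:R + 1) * beta].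
Proof.
move=> b0 b1; have bi1 : 1 < beta^-1 by rewrite invf_gt1.
have c1 : 1 < Num.ceil beta^-1 by rewrite Num.Theory.ceil_gt_int //.
have pE : (pp beta)%:R = (Num.ceil beta^-1)%:~R - 1 :> rat.
  rewrite /pp -[X in X = _]/((_ : nat)%:~R) gez0_abs; last by lia.
  by rewrite rmorphB.
split.
- by rewrite /pp; lia.
- by rewrite pE -ltr_pdivlMr // div1r -[1]/(1%:~R) -rmorphB ceilB1_lt.
- by rewrite pE subrK -ler_pdivrMr // div1r ceil_ge.
Qed.

Lemma gfunE (beta : rat) (u q : nat) : pp beta = q.+1 ->
  gfun u.+2 beta = 'C(q, u.+2)%:R * beta ^+ u.+2
    + 'C(q, u.+1)%:R * (1 - q%:R * beta) * beta ^+ u.+1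
    + 2^-1 * 'C(q, u)%:R * (1 - q.+1%:R * beta) * (1 - q%:R * beta) * beta ^+ u.
Proof.
have binzE x y : binz x%:Z y%:Z = 'C(x, y)%:R.
  by rewrite /binz /= lez_nat; case: leqP => // h; rewrite bin_small.
move=> pE; rewrite /gfun pE.
have -> : q.+1%:Z - 1 = q%:Z by lia.
have -> : u.+2%:Z - 1 = u.+1%:Z by lia.
have -> : u.+2%:Z - 2 = u%:Z by lia.
by rewrite !binzE.
Qed.

(** This is the assertion that [g_t n^t] in place of [k_t] makes the right side of [excessE] vanish,
    divided by [n^(t+2)]. *)
Lemma gfun_rec (beta : rat) (t : nat) : (2 <= t)%N -> (0 < pp beta)%N ->
  (t%:R - 1 + (t%:R + 1) * ((pp beta)%:R + 2 - 2 * t%:R) * beta) * gfun t.+1 beta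
  - (1 - t%:R * beta) * ((pp beta)%:R + 1 - t%:R) * beta * gfun t beta
  = (t%:R - 1) * (t%:R + 2) * gfun t.+2 beta.
Proof.
case: t => [|[|u]] // _; case pE: (pp beta) => [|q] // _.
rewrite !(gfunE _ pE).
(* Writing every binomial as a rational multiple of ['C(q, u)] reduces the claim to a field
   identity; the formula survives [k >= q], where both sides are 0. *)
have binS k : 'C(q, k.+1)%:R = 'C(q, k)%:R * (q%:R - k%:R) / (k%:R + 1) :> rat.
  apply: (canRL (mulfK _)); first by rewrite natr1 pnatr_eq0.
  rewrite natr1 -natrM mulnC mul_bin_left natrM mulrC.
  case: (leqP k q) => [h|h]; first by rewrite natrB.
  by rewrite bin_small // !mul0r.
rewrite !binS !exprS -!natr1; field.
by rewrite !natr1 !pnatr_eq0.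
Qed.

(** The third summand alone is positive, since [t - 2 <= p - 1] and [p * beta < 1]; the other two
    are nonnegative. *)
Lemma gfun_gt0 (beta : rat) (t : nat) : 0 < beta -> beta < 1 ->
  (2 <= t)%N -> (t <= (pp beta).+1)%N -> 0 < gfun t beta.
Proof.
move=> b0 b1; have [] := pp_bounds b0 b1.
case: t => [|[|u]] //; case pE: (pp beta) => [|q] // _ pb _ _ uq.
rewrite (gfunE _ pE).
have qb : 0 < 1 - q%:R * beta by rewrite -natr1 in pb; nra.
move: (exprn_gt0 u b0) (exprn_gt0 u.+1 b0) (exprn_gt0 u.+2 b0).
move: (beta ^+ u) (beta ^+ u.+1) (beta ^+ u.+2) => x y z x0 y0 z0.
apply: ltr_wpDl; first by rewrite addr_ge0 // !mulr_ge0 // ltW.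
by rewrite !mulr_gt0 // ?ltr0n ?bin_gt0 // subr_gt0.
Qed.

Lemma gfun_large (beta : rat) : (0 < pp beta)%N -> gfun (pp beta).+2 beta = 0.
Proof.
case pE: (pp beta) => [|q] // _.
by rewrite (gfunE _ pE) !bin_small ?mulr0 ?mul0r ?addr0 //; lia.
Qed.

(** * Exact counting identities for cliques and common neighbours *)

Section CliqueCounts.
Variables (T : finType) (e : rel T).
Hypotheses (eI : irreflexive e) (eC : symmetric e).

Definition nbhd (A : {set T}) : {set T} := [set v | [forall u in A, e u v]].

Definition cliques (r : nat) : {set {set T}} :=
  [set A : {set T} | (#|A| == r) && is_clique e A].

(** By irreflexivity a vertex of [A] misses itself, so a vertex of a clique misses exactly one of
    its members. *)
Definition miss (A : {set T}) (v : T) : {set T} := [set x in A | ~~ e x v].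

Lemma is_cliqueP (A : {set T}) :
  reflect (forall x y, x \in A -> y \in A -> x != y -> e x y) (is_clique e A).
Proof.
apply: (iffP forall_inP) => [H x y xA yA xy|H x xA].
  by have /forall_inP/(_ y yA)/implyP/(_ xy) := H x xA.
by apply/forall_inP => y yA; apply/implyP; apply: H.
Qed.

Lemma nbhdP (A : {set T}) v :
  reflect (forall u, u \in A -> e u v) (v \in nbhd A).
Proof. by rewrite inE; apply: forall_inP. Qed.

Lemma nbhd_notin (A : {set T}) v : v \in nbhd A -> v \notin A.
Proof. by move/nbhdP=> H; apply/negP => /H; rewrite eI. Qed.

Lemma cliquesP (r : nat) (A : {set T}) :
  reflect (#|A| = r /\ is_clique e A) (A \in cliques r).
Proof. by rewrite inE; apply: (iffP andP) => -[/eqP]. Qed.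

Lemma cliques_setU1 r (A : {set T}) v :
  A \in cliques r -> v \in nbhd A -> v |: A \in cliques r.+1.
Proof.
move=> /cliquesP[<- cA] vA; apply/cliquesP.
rewrite cardsU1 nbhd_notin //; split=> //; apply/is_cliqueP => x y.
have {vA}/nbhdP vA := vA.
rewrite !in_setU1 => /predU1P[->|xA] /predU1P[->|yA]; rewrite ?eqxx // => xy.
- by rewrite eC vA.
- by rewrite vA.
- exact: (is_cliqueP _ cA).
Qed.

Lemma cliques_setD1 r (A : {set T}) v :
  A \in cliques r.+1 -> v \in A -> (A :\ v \in cliques r) /\ v \in nbhd (A :\ v).
Proof.
move=> /cliquesP[cA /is_cliqueP kA] vA; split.
  apply/cliquesP; split; first by move: cA; rewrite (cardsD1 v) vA => -[].
  by apply/is_cliqueP => x y /setD1P[_ xA] /setD1P[_ yA]; apply: kA.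
by apply/nbhdP => u /setD1P[uv uA]; apply: kA.
Qed.

(** The pairs [(S, x)] with [x] in [S] correspond to the pairs [(A, v)] with [v] a common neighbour
    of [A]. For [F] the number of common neighbours, the right side is a sum of squares. *)
Lemma sum_cliques_facets (t : nat) (F : {set T} -> rat) :
  \sum_(S in cliques t.+1) \sum_(x in S) F (S :\ x)
  = \sum_(A in cliques t) #|nbhd A|%:R * F A.
Proof.
have -> : \sum_(A in cliques t) #|nbhd A|%:R * F A
   = \sum_(A in cliques t) \sum_(v in nbhd A) F A.
  by apply: eq_bigr => A _; rewrite sumr_const mulr_natl.
rewrite !pair_big_dep /=.
rewrite (reindex_onto (fun q => (q.2 |: q.1, q.2)) (fun q => (q.1 :\ q.2, q.2)));
  last by move=> [S x] /= /andP[_ xS]; rewrite setD1K.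
apply: eq_big => [[A v]|[A v]] /=.
  apply/andP/andP => [[/andP[H1 H2] /eqP[E]]|[H1 H2]].
    by have [] := cliques_setD1 H1 H2; rewrite E.
  by rewrite cliques_setU1 // setU11 setU1K ?nbhd_notin.
by move=> /andP[_ /eqP[->]].
Qed.

Lemma sum_nbhd_cliques (t : nat) :
  \sum_(A in cliques t) #|nbhd A|%:R = t.+1%:R * (kcl t.+1 e)%:R :> rat.
Proof.
under eq_bigr do rewrite -[_%:R]mulr1.
rewrite -(sum_cliques_facets t (fun=> 1)).
under eq_bigr => S /cliquesP[cS _] do rewrite sumr_const cS.
by rewrite sumr_const mulr_natr.
Qed.

Lemma nbhd_miss0 (A : {set T}) v : (v \in nbhd A) = (#|miss A v| == 0)%N.
Proof.
rewrite cards_eq0; apply/nbhdP/eqP => [H|H u uA].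
  by apply/setP => x; rewrite !inE; apply/negP => /andP[/H ->].
by apply/negPn; move/setP/(_ u): H; rewrite !inE uA => /negbT.
Qed.

Lemma nbhd_setD1 (S : {set T}) x v :
  (v \in nbhd (S :\ x)) = (miss S v \subset [set x]).
Proof.
apply/nbhdP/subsetP => [H u|H u].
  rewrite !inE => /andP[uS]; apply: contraR => ux.
  by apply: H; rewrite !inE ux.
rewrite !inE => /andP[ux uS]; apply: contraR ux => euv.
by rewrite -in_set1 H // inE uS.
Qed.

Lemma sum_miss (A : {set T}) :
  (\sum_v #|miss A v| + \sum_(x in A) vdeg e x = #|A| * #|T|)%N.
Proof.
have -> : (\sum_v #|miss A v| = \sum_(x in A) \sum_v ~~ e x v)%N.
  rewrite exchange_big /=; apply: eq_bigr => v _.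
  by rewrite -sum1dep_card big_mkcondr /=; apply: eq_bigr => x _; case: (e x v).
rewrite -big_split /= -sum_nat_const; apply: eq_bigr => x _.
rewrite /vdeg -sum1dep_card [X in (_ + X)%N]big_mkcond -big_split /= -sum1_card.
by apply: eq_bigr => v _; case: (e x v).
Qed.

(** A vertex missing [m] members contributes [[m = 0] + m] on the left and [1 + m.-1] on the right,
    and these agree for all [m]. *)
Lemma card_nbhd_miss (A : {set T}) :
  (#|nbhd A| + \sum_v #|miss A v| = #|T| + \sum_v #|miss A v|.-1)%N.
Proof.
rewrite -sum1_card big_mkcond -big_split /= -sum1_card -big_split /=.
by apply: eq_bigr => v _; rewrite nbhd_miss0; case: #|miss A v|.
Qed.

(** Compare the contributions of a vertex missing [m] members of [S]: it is a common neighbour of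
    all [t + 2] facets if [m = 0], of one if [m = 1], of none if [m >= 2]. The truncated [m - 2]
    absorbs the last case. *)
Lemma sum_facets_miss (S : {set T}) (t : nat) : #|S| = t.+2 ->
  (\sum_(x in S) #|nbhd (S :\ x)| + \sum_v #|miss S v|
   = 2 * #|T| + t * #|nbhd S| + \sum_v (#|miss S v| - 2))%N.
Proof.
move=> cS.
have -> : (\sum_(x in S) #|nbhd (S :\ x)|
           = \sum_v \sum_(x in S) (miss S v \subset [set x]))%N.
  rewrite exchange_big; apply: eq_bigr => x _.
  rewrite -sum1_card big_mkcond; apply: eq_bigr => v _.
  by rewrite nbhd_setD1; case: (_ \subset _).
rewrite -[#|T|]sum1_card -[#|nbhd S|]sum1_card big_distrr /= [X in (_ + t * X)%N]big_mkcond.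
rewrite big_distrr -!big_split /=; apply: eq_bigr => v _; rewrite nbhd_miss0.
case: (posnP #|miss S v|) => [m0|m0].
  move/cards0_eq: (m0) => ->; rewrite cards0 /=.
  under eq_bigr do rewrite sub0set.
  by rewrite sum1_card cS; lia.
case: (ltngtP #|miss S v| 1) => [|m2|/eqP/cards1P[y My]]; first by lia.
  rewrite big1 ?add0n; first by lia.
  move=> x _; case: subsetP => // /subsetP/subset_leq_card.
  by rewrite cards1; lia.
have yS : y \in S by have : y \in [set y]; [exact: set11 | rewrite -My inE => /andP[]].
rewrite (bigD1 y) //= My subxx big1 ?cards1 ?muln0 //= => x /andP[_ xy].
by rewrite sub1set inE eq_sym (negbTE xy).
Qed.

Section Excess.
Variable beta : rat.
Let n : rat := #|T|%:R.

Definition surplus (x : T) : rat := (vdeg e x)%:R - (1 - beta) * n.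

(** The slack in [(loss)], kept explicit so that the counting stays an identity and equality can be
    analysed term by term. *)
Definition loss (A : {set T}) : rat :=
  (\sum_v (#|miss A v| - 2))%N%:R + \sum_(x in A) surplus x.

Lemma sum_missE (A : {set T}) :
  (\sum_v #|miss A v|)%N%:R = #|A|%:R * beta * n - \sum_(x in A) surplus x :> rat.
Proof.
rewrite sumrB sumr_const -natr_sum -mulr_natl.
have := congr1 (fun k => k%:R : rat) (sum_miss A).
rewrite natrD natrM -/n; lra.
Qed.

Lemma card_nbhdE (A : {set T}) :
  #|nbhd A|%:R = (1 - #|A|%:R * beta) * n + \sum_(x in A) surplus x
                 + (\sum_v #|miss A v|.-1)%N%:R :> rat.
Proof.
have := congr1 (fun k => k%:R : rat) (card_nbhd_miss A).
rewrite !natrD sum_missE -/n; lra.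
Qed.

Lemma sum_facetsE (S : {set T}) (t : nat) : (0 < t)%N -> #|S| = t.+1 ->
  \sum_(x in S) #|nbhd (S :\ x)|%:R
  = (2 - t.+1%:R * beta) * n + (t%:R - 1) * #|nbhd S|%:R + loss S :> rat.
Proof.
case: t => // t _ cS; have := congr1 (fun k => k%:R : rat) (sum_facets_miss cS).
rewrite !natrD !natrM sum_missE cS /loss -natr_sum -/n -!natr1; lra.
Qed.

Definition spread (p : nat) (A : {set T}) : rat :=
  (#|nbhd A|%:R - (1 - #|A|%:R * beta) * n)
  * ((p%:R + 1 - #|A|%:R) * beta * n - #|nbhd A|%:R).

(** The spreads contribute minus the sum of [d(A)^2], the facet sums of the losses contribute plus
    the same sum. What is left is linear in [d], hence in the clique numbers. *)
Lemma excessE (p t : nat) : (0 < t)%N ->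
  \sum_(A in cliques t) spread p A + \sum_(S in cliques t.+1) loss S
  = (t%:R - 1 + (t%:R + 1) * (p%:R + 2 - 2 * t%:R) * beta) * n * (kcl t.+1 e)%:R
    - (1 - t%:R * beta) * (p%:R + 1 - t%:R) * beta * n ^+ 2 * (kcl t e)%:R
    - (t%:R - 1) * (t%:R + 2) * (kcl t.+2 e)%:R.
Proof.
move=> t0; set d := fun A : {set T} => #|nbhd A|%:R : rat.
have -> : \sum_(A in cliques t) spread p A
  = (1 - t%:R * beta + (p%:R + 1 - t%:R) * beta) * n * \sum_(A in cliques t) d A
    - \sum_(A in cliques t) d A * d A
    - (1 - t%:R * beta) * (p%:R + 1 - t%:R) * beta * n ^+ 2 * (kcl t e)%:R.
  rewrite /kcl -sum1_card natr_sum !mulr_sumr -!sumrB.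
  by apply: eq_bigr => A /cliquesP[cA _]; rewrite /spread cA /d; ring.
have -> : \sum_(S in cliques t.+1) loss S
  = \sum_(S in cliques t.+1) \sum_(x in S) d (S :\ x)
    - (2 - t.+1%:R * beta) * n * (kcl t.+1 e)%:R
    - (t%:R - 1) * \sum_(S in cliques t.+1) d S.
  rewrite /kcl -[#|cliques t.+1|]sum1_card natr_sum !mulr_sumr -!sumrB.
  by apply: eq_bigr => S /cliquesP[cS _]; rewrite (sum_facetsE t0 cS) /d; ring.
rewrite sum_cliques_facets !sum_nbhd_cliques -!natr1; ring.
Qed.

End Excess.
End CliqueCounts.

(** * Monotonicity of the ratios under the degree and freeness hypotheses *)

Section MinDegree.
Variables (T : finType) (e : rel T) (beta : rat).
Hypotheses (eI : irreflexive e) (eC : symmetric e).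
Hypotheses (beta0 : 0 < beta) (beta1 : beta < 1).
Local Notation n := (#|T|%:R : rat).
Local Notation p := (pp beta).
Hypothesis mindeg : forall v, (1 - beta) * n <= (vdeg e v)%:R.

Lemma surplus_ge0 x : 0 <= surplus e beta x.
Proof. by rewrite subr_ge0. Qed.

Lemma loss_ge0 (S : {set T}) : 0 <= loss e beta S.
Proof. by rewrite addr_ge0 ?ler0n ?sumr_ge0 // => x _; apply: surplus_ge0. Qed.

Lemma card_nbhd_ge (A : {set T}) : (1 - #|A|%:R * beta) * n <= #|nbhd e A|%:R.
Proof.
by rewrite (card_nbhdE _ beta) -addrA lerDl addr_ge0 ?ler0n ?sumr_ge0 // => x _;
  apply: surplus_ge0.
Qed.

(** The new vertex has at most [beta * n] non-neighbours, so at most that many common neighbours are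
    lost. *)
Lemma card_nbhd_setU1 (A : {set T}) v :
  #|nbhd e A|%:R <= #|nbhd e (v |: A)|%:R + beta * n :> rat.
Proof.
have H : (#|nbhd e A| + vdeg e v <= #|nbhd e (v |: A)| + #|T|)%N.
  have -> : nbhd e (v |: A) = nbhd e A :&: [set u | e v u].
    apply/setP => u; apply/nbhdP/setIP => [H|[/nbhdP H]].
      by split; [apply/nbhdP => x xA; apply: H; rewrite inE xA orbT
                | rewrite inE H ?setU11].
    by rewrite inE => evu x /setU1P[->|/H].
  by rewrite /vdeg -cardsUI addnC leq_add2l max_card.
have := mindeg v; move: H; rewrite -(ler_nat rat) !natrD; lra.
Qed.

Hypothesis free : kcl (p + 2) e = 0%N.

Lemma cliques_pp2 : cliques e p.+2 = set0.
Proof. by apply/eqP; rewrite -cards_eq0 -/(kcl _ _) -addn2 free. Qed.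

(** Extend [A] by common neighbours: each extension loses at most [beta * n] of them, and a
    [(p+1)]-clique has none left. *)
Lemma card_nbhd_le (t : nat) (A : {set T}) : (t <= p.+1)%N -> A \in cliques e t ->
  #|nbhd e A|%:R <= (p%:R + 1 - t%:R) * beta * n.
Proof.
have bound_ge0 (r : nat) : (r <= p.+1)%N -> 0 <= (p%:R + 1 - r%:R) * beta * n.
  by move=> rp; rewrite !mulr_ge0 ?ler0n ?(ltW beta0) // natr1 subr_ge0 ler_nat.
move=> tp; move: {2}(p.+1 - t)%N (erefl (p.+1 - t)%N) => k.
elim: k t A tp => [|k IH] t A tp kE AK;
  have [->|[v vA]] := set_0Vmem (nbhd e A).
- by rewrite cards0; apply: bound_ge0.
- have := cliques_setU1 eI eC AK vA.
  have -> : t.+1 = p.+2 by lia.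
  by rewrite cliques_pp2 in_set0.
- by rewrite cards0; apply: bound_ge0.
- have := IH t.+1 (v |: A) _ _ (cliques_setU1 eI eC AK vA).
  have := card_nbhd_setU1 A v; rewrite -natr1 => H1 H2.
  by have {}H2 := H2 ltac:(lia) ltac:(lia); lra.
Qed.

Lemma spread_ge0 (t : nat) (A : {set T}) : (t <= p.+1)%N -> A \in cliques e t ->
  0 <= spread e beta p A.
Proof.
move=> tp AK; rewrite mulr_ge0 ?subr_ge0 ?card_nbhd_ge //.
by have /cliquesP[-> _] := AK; apply: card_nbhd_le.
Qed.

Hypothesis n0 : 0 < n.

(** Greedy extension: a clique of size [t <= p] has at least [(1 - t * beta) * n > 0] common
    neighbours. *)
Lemma cliques_exist (t : nat) : (t <= p.+1)%N -> exists A, A \in cliques e t.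
Proof.
elim: t => [|t IH] tp.
  by exists set0; apply/cliquesP; rewrite cards0; split=> //;
    apply/is_cliqueP => x y; rewrite inE.
have [A AK] := IH (ltnW tp); have /cliquesP[cA _] := AK.
have [A0|[v vA]] := set_0Vmem (nbhd e A); last first.
  by exists (v |: A); apply: cliques_setU1.
have [_ pb _] := pp_bounds beta0 beta1.
have := card_nbhd_ge A; rewrite A0 cards0 cA pmulr_lle0 // subr_le0.
by rewrite leNgt (le_lt_trans _ pb) // ler_wpM2r ?(ltW beta0) // ler_nat.
Qed.

Local Notation ratio := (clq_ratio e beta).

Definition excess (t : nat) : rat :=
  \sum_(A in cliques e t) spread e beta p A + \sum_(S in cliques e t.+1) loss e beta S.

Lemma excess_ge0 (t : nat) : (t <= p)%N -> 0 <= excess t.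
Proof.
move=> tp; rewrite addr_ge0 ?sumr_ge0 // => A AK; last exact: loss_ge0.
by apply: spread_ge0 AK; apply: leqW.
Qed.

(** At [t = p + 2] the ratio has denominator 0, but both sides vanish; including this case makes
    [ratio_step] uniform up to [t = p]. *)
Lemma kcl_ratio (t : nat) : (2 <= t)%N -> (t <= p.+2)%N ->
  (kcl t e)%:R = ratio t * gfun t beta * n ^+ t.
Proof.
move=> t2; rewrite leq_eqVlt => /predU1P[->|tp].
  have [p0 _ _] := pp_bounds beta0 beta1.
  by rewrite gfun_large // mulr0 mul0r -addn2 free.
rewrite /clq_ratio -mulrA divfK // mulf_neq0 ?expf_neq0 ?(gt_eqF n0) //.
by rewrite gt_eqF // gfun_gt0.
Qed.

(** Up to sign, the coefficient of [ratio t] once [kcl_ratio] is substituted into [excessE]. *)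
Definition descent (t : nat) : rat :=
  (1 - t%:R * beta) * (p%:R + 1 - t%:R) * beta * gfun t beta * n ^+ t.+2.

Lemma descent_gt0 (t : nat) : (2 <= t)%N -> (t <= p)%N -> 0 < descent t.
Proof.
move=> t2 tp; have [p0 pb _] := pp_bounds beta0 beta1.
have g0 := gfun_gt0 beta0 beta1 t2 (leqW tp).
have tpR : t%:R <= p%:R :> rat by rewrite ler_nat.
have tb : t%:R * beta <= p%:R * beta by rewrite ler_pM2r.
have [tb0 tp0] : 0 < 1 - t%:R * beta /\ 0 < p%:R + 1 - t%:R :> rat by split; lra.
rewrite /descent; move: (n ^+ _) (exprn_gt0 t.+2 n0) => m m0.
by rewrite !mulr_gt0.
Qed.

(** After substituting [kcl_ratio] into [excessE], the recurrence [gfun_rec] splits the coefficient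
    of [ratio t.+1] into those of [ratio t] and [ratio t.+2], so only differences of ratios
    remain. *)
Lemma ratio_step (t : nat) : (2 <= t)%N -> (t <= p)%N ->
  descent t * (ratio t.+1 - ratio t)
  = excess t + (t%:R - 1) * (t%:R + 2) * gfun t.+2 beta * n ^+ t.+2
               * (ratio t.+2 - ratio t.+1).
Proof.
move=> t2 tp; have [p0 _ _] := pp_bounds beta0 beta1.
rewrite /excess excessE //; last exact: ltnW.
rewrite !kcl_ratio //; try lia.
rewrite /descent !exprS; move: (n ^+ t) => m.
have := gfun_rec t2 p0; move: (gfun t beta) (gfun t.+1 beta) (gfun t.+2 beta).
move=> g0 g1 g2.
move/eqP; rewrite subr_eq => /eqP G.
transitivity (n * n * m * (ratio t.+1 * ((t%:R - 1) * (t%:R + 2) * g2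
    + (1 - t%:R * beta) * (p%:R + 1 - t%:R) * beta * g0)
  - (t%:R - 1) * (t%:R + 2) * g2 * ratio t.+1
  - (1 - t%:R * beta) * (p%:R + 1 - t%:R) * beta * g0 * ratio t)); first by ring.
rewrite -G; ring.
Qed.

Lemma gfun_ge0 (t : nat) : (2 <= t)%N -> (t <= p.+2)%N -> 0 <= gfun t beta.
Proof.
move=> t2; rewrite leq_eqVlt => /predU1P[->|tp]; last exact/ltW/gfun_gt0.
by have [p0 _ _] := pp_bounds beta0 beta1; rewrite gfun_large.
Qed.

Lemma ratio_step_coef (t : nat) : (2 <= t)%N -> (t <= p)%N ->
  0 <= (t%:R - 1) * (t%:R + 2) * gfun t.+2 beta * n ^+ t.+2.
Proof.
move=> t2 tp; have t2R : 2 <= t%:R :> rat by rewrite ler_nat.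
have g0 : 0 <= gfun t.+2 beta by rewrite gfun_ge0 //; lia.
have [h1 h2] : 0 <= t%:R - 1 :> rat /\ 0 <= t%:R + 2 :> rat by split; lra.
move: (n ^+ _) (exprn_ge0 t.+2 (ltW n0)) => m m0.
by rewrite !mulr_ge0.
Qed.

(* The step at [t = p] needs no induction hypothesis, as [g_{p+2} = 0]. *)
Lemma ratio_leS (t : nat) : (2 <= t)%N -> (t <= p)%N -> ratio t <= ratio t.+1.
Proof.
move=> t2 tp; move: {2}(p - t)%N (erefl (p - t)%N) => k.
elim: k t t2 tp => [|k IH] t t2 tp kE; rewrite -subr_ge0;
  rewrite -(pmulr_rge0 _ (descent_gt0 t2 tp)) ratio_step // addr_ge0 ?excess_ge0 //.
  have -> : t = p by lia.
  by have [p0 _ _] := pp_bounds beta0 beta1; rewrite gfun_large // mulr0 !mul0r.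
by rewrite mulr_ge0 ?ratio_step_coef // subr_ge0 IH //; lia.
Qed.

Lemma ratio_mono (s t : nat) : (2 <= t)%N -> (t <= s)%N -> (s <= p.+1)%N ->
  ratio t <= ratio s.
Proof.
move=> t2; elim: s => [|s IH]; first by rewrite leqn0 => /eqP->.
rewrite leq_eqVlt => /predU1P[->//|ts] sp.
by apply: le_trans (IH _ _) _; rewrite ?ratio_leS //; lia.
Qed.

(** With zero excess [ratio_step] is homogeneous, and its last term is 0 at [t = p]; all differences
    then vanish by downward induction. *)
Lemma excess_eq0_ratio (s t : nat) : (forall r, (2 <= r)%N -> (r <= p)%N -> excess r = 0) ->
  (2 <= t)%N -> (t < s)%N -> (s <= p.+1)%N -> ratio s = ratio t.
Proof.
move=> X0 t2 ts sp.
have step r : (2 <= r)%N -> (r <= p)%N -> ratio r.+1 = ratio r.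
  move=> r2 rp; move: {2}(p - r)%N (erefl (p - r)%N) => k.
  elim: k r r2 rp => [|k IH] r r2 rp kE; apply/eqP; rewrite -subr_eq0;
    rewrite -(mulrI_eq0 _ (mulfI (lt0r_neq0 (descent_gt0 r2 rp)))) ratio_step //;
    rewrite X0 // add0r.
    have -> : r = p by lia.
    by have [p0 _ _] := pp_bounds beta0 beta1; rewrite gfun_large // mulr0 !mul0r.
  by rewrite IH ?subrr ?mulr0 //; lia.
elim: s ts sp => // s IH; rewrite ltnS leq_eqVlt => /predU1P[<-|ts] sp.
  by rewrite step.
by rewrite step ?IH //; lia.
Qed.

(* Equality at any step propagates upwards to the step [t = p], the only one
   that is needed to recover the extremal structure. *)
Lemma ratio_eq_excess (s t : nat) : (2 <= t)%N -> (t < s)%N -> (s <= p.+1)%N ->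
  ratio s = ratio t -> excess p = 0.
Proof.
move=> t2 ts sp Est.
(* Monotonicity squeezes [ratio t.+1] between [ratio t] and [ratio s]. *)
have : ratio t.+1 = ratio t.
  apply/eqP; rewrite eq_le ratio_leS ?andbT //; last lia.
  by rewrite -Est ratio_mono //; lia.
have {s ts sp Est} : (t <= p)%N by lia.
move=> tp; move: {2}(p - t)%N (erefl (p - t)%N) => k.
elim: k t t2 tp => [|k IH] t t2 tp kE Et; have := ratio_step t2 tp;
  rewrite Et subrr mulr0.
  have -> : t = p by lia.
  by have [p0 _ _] := pp_bounds beta0 beta1;
    rewrite gfun_large // mulr0 !mul0r addr0 => <-.
have r0 : 0 <= ratio t.+2 - ratio t by rewrite -Et subr_ge0 ratio_leS //; lia.
have t2R : 2 <= t%:R :> rat by rewrite ler_nat.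
have [h1 h2] : 0 < t%:R - 1 :> rat /\ 0 < t%:R + 2 :> rat by split; lra.
have g0 : 0 < gfun t.+2 beta by apply: gfun_gt0 => //; lia.
move/esym/eqP; rewrite paddr_eq0 ?excess_ge0 ?(mulr_ge0 (ratio_step_coef t2 tp)) //.
case/andP=> _; move: (n ^+ _) (exprn_gt0 t.+2 n0) => m m0.
rewrite mulf_eq0 (gt_eqF (mulr_gt0 (mulr_gt0 (mulr_gt0 h1 h2) g0) m0)) subr_eq0 /=.
by rewrite -Et => /eqP; apply: IH; lia.
Qed.

End MinDegree.

(** * Injective homomorphisms, subcliques and the handshake lemma *)

Section InjectiveHom.
Variables (U T : finType) (e' : rel U) (e : rel T) (h : U -> T).
Hypotheses (hI : injective h) (hE : forall x y, e' x y -> e (h x) (h y)).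

Lemma kcl_inj_le r : (kcl r e' <= kcl r e)%N.
Proof.
rewrite /kcl -(card_imset _ (imset_inj hI)); apply: subset_leq_card.
apply/subsetP => _ /imsetP[A + ->]; rewrite !inE => /andP[/eqP cA /is_cliqueP kA].
rewrite card_imset // cA eqxx /=; apply/is_cliqueP.
move=> _ _ /imsetP[x xA ->] /imsetP[y yA ->]; rewrite (inj_eq hI) => xy.
exact/hE/kA.
Qed.

End InjectiveHom.

Lemma clique_subset (T : finType) (e : rel T) (A B : {set T}) :
  A \subset B -> is_clique e B -> is_clique e A.
Proof.
move=> /subsetP AB /is_cliqueP kB; apply/is_cliqueP => x y /AB xB /AB yB.
exact: kB.
Qed.

(** The case [t = 1] of [sum_nbhd_cliques]: the degrees sum to twice the number of edges. *)
Lemma even_sum_vdeg (T : finType) (e : rel T) : simple_graph e ->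
  ~~ odd (\sum_v vdeg e v).
Proof.
move=> [eI eC]; have K1 : cliques e 1 = [set [set v] | v in T].
  apply/setP => A; apply/cliquesP/imsetP => [[/eqP/cards1P[v ->] _]|[v _ ->]].
    by exists v.
  rewrite cards1; split=> //; apply/is_cliqueP => x y.
  by rewrite !inE => /eqP-> /eqP->; rewrite eqxx.
have := sum_nbhd_cliques eI eC 1; rewrite K1 big_imset /=; last first.
  by move=> x y _ _ /set1_inj.
under eq_bigr => v _.
  have -> : nbhd e [set v] = [set u | e v u].
    apply/setP => u; rewrite inE; apply/nbhdP/idP => [H|evu x /set1P->//].
    by apply: H; rewrite inE.
  over.
rewrite -natr_sum -natrM => /eqP; rewrite eqr_nat => /eqP E.
by rewrite /vdeg E oddM.
Qed.

(** * Partitioned graphs with triangle-free [V_0] have zero excess *)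

Section Partition.
Variables (T : finType) (e : rel T) (beta : rat).
Hypotheses (eI : irreflexive e) (eC : symmetric e).
Local Notation n := (#|T|%:R : rat).
Local Notation p := (pp beta).

(** The conditions of [family_part] with minimality of the triangle count replaced by its being 0,
    so that no other graph has to be mentioned. *)
Definition triangle_free_partition (f : T -> 'I_p) : Prop :=
  [/\ #|part0 f|%:R = (1 - (p.-1)%:R * beta) * n,
      forall i : 'I_p, (0 < i)%N -> #|[set v | f v == i]|%:R = beta * n,
      forall u v, f u != f v -> e u v,
      forall u v, (0 < f u)%N -> f u = f v -> ~~ e u v &
      forall v, v \in part0 f ->
        #|[set u in part0 f | e v u]|%:R = (1 - p%:R * beta) * n]
  /\ kcl 3 (induced e (part0 f)) = 0%N.

Section Counting.
Variable f : T -> 'I_p.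
Hypothesis fP : triangle_free_partition f.

(** A vertex outside [V_0] misses exactly its class, of size [beta * n]; one in [V_0] sees all other
    classes and [(1 - p * beta) * n] vertices of its own. *)
Lemma partition_regular v : (0 < p)%N -> surplus e beta v = 0.
Proof.
move=> p0; have [[c0 ci cross indep reg] _] := fP.
apply/eqP; rewrite subr_eq0; apply/eqP; case: (posnP (f v)) => fv0.
  have vV0 : v \in part0 f by rewrite inE fv0.
  rewrite /vdeg -(cardsID (part0 f)) natrD.
  have -> : [set u | e v u] :&: part0 f = [set u in part0 f | e v u].
    by apply/setP => u; rewrite !inE andbC.
  have -> : [set u | e v u] :\: part0 f = ~: part0 f.
    apply/setP => u; rewrite !inE; case: eqP => //= /eqP fu0.
    by apply/cross/negP => /eqP E; rewrite -E fv0 in fu0.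
  have := congr1 (fun k => k%:R : rat) (cardsC (part0 f)).
  have pE : p%:R = p.-1%:R + 1 :> rat by rewrite natr1 prednK.
  by rewrite natrD reg // c0 pE; lra.
have -> : vdeg e v = #|~: [set u | f u == f v]|.
  apply: eq_card => u; rewrite !inE; case: eqP => [E|/eqP E] /=.
    by apply/negbTE/indep.
  by rewrite cross // eq_sym.
have := congr1 (fun k => k%:R : rat) (cardsC [set u | f u == f v]).
rewrite natrD ci //; lra.
Qed.

Lemma card_clique_part0 (A : {set T}) : is_clique e A ->
  (#|A :&: part0 f| <= 2)%N.
Proof.
move=> kA; have [_ /eqP tf] := fP; rewrite leqNgt; apply/negP => /card_geqP[s [us cs sA]].
move: tf; rewrite cards_eq0 => /eqP/setP/(_ [set x in s]).
rewrite in_set0 inE cardsE -cs (card_uniqP us) eqxx /= => /negP; apply.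
apply/is_cliqueP => x y; rewrite !inE => /sA; rewrite inE => /andP[xA x0].
move=> /sA; rewrite inE => /andP[yA y0] xy.
by rewrite /induced x0 y0 /=; apply: (is_cliqueP _ _ kA).
Qed.

Lemma clique_part_inj (A : {set T}) x y : is_clique e A -> x \in A -> y \in A ->
  (0 < f x)%N -> f x = f y -> x = y.
Proof.
move=> /is_cliqueP kA xA yA fx fxy; have [[_ _ _ indep _] _] := fP.
by apply/eqP; apply: contraT => xy; have := indep _ _ fx fxy; rewrite kA.
Qed.

Lemma card_miss_pos (A : {set T}) v : is_clique e A -> (0 < f v)%N ->
  (#|miss e A v| <= 1)%N.
Proof.
move=> kA fv; have [[_ _ cross _ _] _] := fP.
have missE x : x \in miss e A v -> x \in A /\ f x = f v.
  rewrite inE => /andP[xA]; split=> //; apply/eqP.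
  by apply: contraR b => /cross.
apply/card_le1_eqP => x y /missE[xA fx] /missE[yA fy].
by apply: clique_part_inj kA _ _ _ _; rewrite ?fx ?fy.
Qed.

Lemma card_miss_zero (A : {set T}) v : f v = 0%N :> nat ->
  (#|miss e A v| <= #|A :&: part0 f|)%N.
Proof.
move=> fv; have [[_ _ cross _ _] _] := fP.
apply/subset_leq_card/subsetP => x; rewrite !inE => /andP[-> /=].
by apply: contraR => fx; apply/cross/negP => /eqP E; rewrite E fv in fx.
Qed.

(** No vertex misses more than two members of a clique: non-neighbours lie in its own class, which a
    clique meets at most twice for [V_0] and at most once otherwise. *)
Lemma partition_loss (S : {set T}) : (0 < p)%N -> is_clique e S -> loss e beta S = 0.
Proof.
move=> p0 kS; rewrite /loss [X in _ + X]big1 => [|x _]; last exact: partition_regular.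
rewrite big1 ?addr0 // => v _; apply/eqP; rewrite subn_eq0.
case: (posnP (f v)) => fv.
  exact: leq_trans (card_miss_zero S fv) (card_clique_part0 kS).
exact: leqW (card_miss_pos kS fv).
Qed.

(* A clique with two vertices in [V_0] has no common neighbour there, so its
   common neighbourhood is the union of the classes that it does not meet. *)
Lemma partition_spread (A : {set T}) : (0 < p)%N -> is_clique e A ->
  spread e beta p A = 0.
Proof.
move=> p0 kA; have [[_ ci cross _ _] _] := fP.
have reg v := partition_regular v p0.
case: (leqP #|A :&: part0 f| 1) => A0.
  (* If the clique meets [V_0] at most once, no vertex misses two of its members, and the first
     factor of the spread is 0. *)
  rewrite /spread (card_nbhdE e beta) (eq_bigr (fun=> 0)) // big1_eq addr0.
  rewrite big1 ?addr0 ?subrr ?mul0r //.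
  move=> v _; case: (posnP (f v)) => fv.
    by have := leq_trans (card_miss_zero A fv) A0; case: #|_| => [|[]].
  by have := card_miss_pos kA fv; case: #|_| => [|[]].
have {A0} A2 : #|A :&: part0 f| = 2%N.
  by apply/eqP; rewrite eqn_leq A0 card_clique_part0.
have nbE : nbhd e A = [set v | f v \in ~: (f @: A)].
  apply/setP => v; rewrite [RHS]inE in_setC; apply/nbhdP/idP => [H|H u uA].
    apply/imsetP => -[x xA fvx].
    case: (posnP (f v)) => fv; last first.
      have [[_ _ _ indep _] _] := fP.
      by have := indep _ _ fv fvx; rewrite eC H.
    have vA : v \notin A by apply/negP => /H; rewrite eI.
    have kvA : is_clique e (v |: A).
      have AK : A \in cliques e #|A| by apply/cliquesP.
      by have /cliquesP[] := cliques_setU1 eI eC AK (introT (nbhdP e A v) H).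
    have := card_clique_part0 kvA.
    have -> : (v |: A) :&: part0 f = v |: (A :&: part0 f).
      by apply/setP => y; rewrite !inE; case: eqP => //= ->; rewrite fv.
    by rewrite cardsU1 inE (negbTE vA) A2.
  by apply: cross; apply: contraNneq H => E; apply/imsetP; exists u.
(* The two vertices in [V_0] share a class index and all others have distinct ones. *)
have cE : #|f @: A|.+1 = #|A|.
  have [x xA0] : exists x, x \in A :&: part0 f by apply/card_gt0P; rewrite A2.
  have -> : f @: A = f x |: f @: (A :\: part0 f).
    move: xA0; rewrite !inE => /andP[xA /eqP fx].
    rewrite -(setID A (part0 f)) {1}(setIC A) imsetU; congr (_ :|: _); last by rewrite setID.
    apply/setP => i; rewrite inE; apply/imsetP/eqP => [[y]|->].
      by rewrite !inE => /andP[/eqP fy _] ->; apply: val_inj; rewrite /= fy fx.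
    by exists x; rewrite // !inE xA fx.
  rewrite cardsU1 card_in_imset; last first.
    move=> y z; rewrite !inE -!lt0n => /andP[fy yA] /andP[_ zA].
    exact: clique_part_inj kA yA zA fy.
  rewrite -(cardsID (part0 f) A) A2 -[2%N]/(1 + 1)%N -add1n addnA; congr (_ + _ + _)%N.
  case: imsetP => // -[y]; rewrite !inE => /andP[+ _] E.
  by move: xA0; rewrite !inE => /andP[_]; rewrite E => ->.
have cN : #|nbhd e A|%:R = #|~: (f @: A)|%:R * (beta * n).
  have -> : #|nbhd e A| = (\sum_(i in ~: (f @: A)) #|[set v | f v == i]|)%N.
    rewrite nbE -sum1dep_card (partition_big f (fun i => i \in ~: (f @: A))) //=.
    apply: eq_bigr => i iA; rewrite -sum1dep_card; apply: eq_bigl => v.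
    by case: eqP => [->|]; rewrite ?andbF ?andbT.
  rewrite natr_sum mulr_natl -sumr_const; apply: eq_bigr => i; rewrite inE => iA.
  apply: ci; rewrite lt0n; apply: contra iA => /eqP i0.
  have /card_gt0P[x] : (0 < #|A :&: part0 f|)%N by rewrite A2.
  rewrite !inE => /andP[xA /eqP fx]; apply/imsetP; exists x => //.
  by apply: val_inj; rewrite /= fx.
have := congr1 (fun k => k%:R : rat) (cardsC (f @: A)).
rewrite natrD card_ord /spread cN -cE -natr1 => H.
apply/eqP; rewrite mulf_eq0; apply/orP; right; apply/eqP.
have -> : p%:R = #|f @: A|%:R + #|~: (f @: A)|%:R :> rat by rewrite H.
ring.
Qed.

End Counting.

Lemma partition_excess (f : T -> 'I_p) (t : nat) : (0 < p)%N ->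
  triangle_free_partition f -> excess e beta t = 0.
Proof.
move=> p0 fP; rewrite /excess !big1 ?addr0 // => A /cliquesP[_ kA].
  exact: (partition_loss fP).
exact: (partition_spread fP).
Qed.

End Partition.

(** * Recovering the partition from zero excess at [t = p] *)

Section Extremal.
Variables (T : finType) (e : rel T) (beta : rat).
Hypotheses (eI : irreflexive e) (eC : symmetric e).
Hypotheses (beta0 : 0 < beta) (beta1 : beta < 1).
Local Notation n := (#|T|%:R : rat).
Local Notation p := (pp beta).
Hypothesis mindeg : forall v, (1 - beta) * n <= (vdeg e v)%:R.
Hypothesis free : kcl (p + 2) e = 0%N.
Hypothesis n0 : 0 < n.
Hypothesis X0 : excess e beta p = 0.

Lemma extremal_spread (A : {set T}) : A \in cliques e p -> spread e beta p A = 0.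
Proof.
move=> AK; move/eqP: X0; rewrite paddr_eq0 ?sumr_ge0 // => [|B BK|S _].
- by case/andP=> /eqP/psumr_eq0P-> // B BK; apply: spread_ge0 BK.
- exact: spread_ge0 BK.
- exact: loss_ge0.
Qed.

Lemma extremal_loss (S : {set T}) : S \in cliques e p.+1 -> loss e beta S = 0.
Proof.
move=> SK; move/eqP: X0; rewrite paddr_eq0 ?sumr_ge0 // => [|B BK|R _].
- by case/andP=> _ /eqP/psumr_eq0P-> // R _; apply: loss_ge0.
- exact: spread_ge0 BK.
- exact: loss_ge0.
Qed.

Lemma extremal_surplus (S : {set T}) x : S \in cliques e p.+1 -> x \in S ->
  surplus e beta x = 0.
Proof.
move=> /extremal_loss/eqP; rewrite paddr_eq0 ?ler0n ?sumr_ge0 // => [|y _].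
  by case/andP=> _ /eqP/psumr_eq0P H xS; apply: H => // y _; apply: surplus_ge0.
exact: surplus_ge0.
Qed.

Lemma nbhd_max (S : {set T}) : S \in cliques e p.+1 -> nbhd e S = set0.
Proof.
move=> SK; have [//|[v vS]] := set_0Vmem (nbhd e S).
by have := cliques_setU1 eI eC SK vS; rewrite cliques_pp2 // in_set0.
Qed.

Definition heavy (S : {set T}) : {set T} :=
  [set x in S | #|nbhd e (S :\ x)|%:R == beta * n].

(* Every facet of a [(p+1)]-clique has degree [beta * n] or [(1 - p * beta) * n],
   and the sum of these degrees is known; when [(p + 1) * beta = 1] the two
   values coincide and all the facets are heavy. *)
Lemma card_heavy (S : {set T}) : (0 < p)%N -> S \in cliques e p.+1 ->
  (p.-1 <= #|heavy S|)%N.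
Proof.
move=> p0 SK; have /cliquesP[cS _] := SK.
have [_ pb1 pb2] := pp_bounds beta0 beta1.
have light x : x \in S -> x \notin heavy S ->
    #|nbhd e (S :\ x)|%:R = (1 - p%:R * beta) * n.
  move=> xS; rewrite inE xS /= => xH.
  have [FK _] := cliques_setD1 SK xS; have /cliquesP[cF _] := FK.
  have := extremal_spread FK; rewrite /spread cF => /eqP.
  rewrite mulf_eq0 !subr_eq0 => /orP[/eqP//|/eqP E].
  by move: xH; rewrite -E; case/eqP; ring.
have [H1|H1] := eqVneq (heavy S) S; first by rewrite H1 cS; lia.
have /properP[_ [y yS yH]] : heavy S \proper S.
  by rewrite properEneq H1; apply/subsetP => x; rewrite inE => /andP[].
have bne : (p%:R + 1) * beta - 1 != 0.
  apply: contra yH => /eqP E; rewrite inE yS; apply/eqP.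
  move: (light y yS); case: (boolP (y \in heavy S)) => [|_ ->//].
    by rewrite inE => /andP[_ /eqP].
  by have -> : 1 - p%:R * beta = beta by lra.
have := sum_facetsE e beta p0 cS.
rewrite (extremal_loss SK) (nbhd_max SK) cards0 mulr0 !addr0.
rewrite (big_setID (heavy S)) /=.
rewrite (eq_bigr (fun=> beta * n)); last first.
  by move=> x; rewrite !inE => /andP[_ /andP[_ /eqP]].
rewrite [X in _ + X](eq_bigr (fun=> (1 - p%:R * beta) * n)); last first.
  by move=> x /setDP[xS]; apply: light.
rewrite !sumr_const (setIidPr _); last by apply/subsetP => x; rewrite inE => /andP[].
have := congr1 (fun k => k%:R : rat) (cardsID (heavy S) S).
rewrite (setIidPr _); last by apply/subsetP => x; rewrite inE => /andP[].
rewrite natrD cS -(natr1 p) => cD.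
rewrite -[X in X + _ = _]mulr_natl -[X in _ + X = _]mulr_natl => E.
have dE : #|S :\: heavy S|%:R = p%:R + 1 - #|heavy S|%:R :> rat by rewrite -cD; ring.
(* With [h] heavy facets, the degree sum [h * beta * n + (p + 1 - h) * (1 - p * beta) * n] equals
   [(2 - (p + 1) * beta) * n]; the difference factors. *)
have {}E : ((p%:R + 1) * beta - 1) * n * (#|heavy S|%:R - (p%:R - 1)) = 0.
  move/eqP: E; rewrite dE -subr_eq0 => /eqP E; apply: etrans E; ring.
move/eqP: E; rewrite !mulf_eq0 (negbTE bne) (gt_eqF n0) /= subr_eq0 => /eqP E.
by rewrite -(ler_nat rat) E -subn1 natrB.
Qed.

Lemma extremal_facet (S : {set T}) x w : S \in cliques e p.+1 -> x \in S ->
  w \in nbhd e (S :\ x) -> w |: S :\ x \in cliques e p.+1.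
Proof. by move=> SK xS; apply: cliques_setU1 => //; have [] := cliques_setD1 SK xS. Qed.

(** Replacing [x] by [u] gives another [(p+1)]-clique. It has no common neighbour, so [u] has no
    neighbour in [W]; its degree [(1 - beta) * n = n - #|W|] then leaves it joined to everything
    outside [W]. *)
Lemma extremal_class (S : {set T}) x u v : S \in cliques e p.+1 ->
  x \in heavy S -> u \in nbhd e (S :\ x) -> e u v = (v \notin nbhd e (S :\ x)).
Proof.
move=> SK; rewrite inE => /andP[xS /eqP cW] uW.
set W := nbhd e (S :\ x) in cW uW *.
have UK := extremal_facet SK xS uW.
have sub : [set y | e u y] \subset ~: W.
  apply/subsetP => y; rewrite in_setC inE => euy; apply/negP => yW.
  have : y \in nbhd e (u |: S :\ x).
    by apply/nbhdP => z /setU1P[->//|]; apply: (nbhdP _ _ _ yW).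
  by rewrite nbhd_max // in_set0.
have /eqP E : [set y | e u y] == ~: W.
  rewrite eqEcard sub /= -(ler_nat rat).
  have /eqP := extremal_surplus UK (setU11 _ _); rewrite subr_eq0 /vdeg => /eqP->.
  have := congr1 (fun k => k%:R : rat) (cardsC W).
  by rewrite natrD cW; lra.
by have := congr1 (fun X : {set T} => v \in X) E; rewrite !inE.
Qed.

(** For distinct [x] and [y] the two facets cover [S], so a shared vertex would extend [S] to a
    [(p+2)]-clique. *)
Lemma extremal_disjoint (S : {set T}) x y v : S \in cliques e p.+1 ->
  x \in S -> y \in S -> v \in nbhd e (S :\ x) -> v \in nbhd e (S :\ y) -> x = y.
Proof.
move=> SK xS yS /nbhdP vx /nbhdP vy; apply/eqP; apply: contraT => xy.
have : v \in nbhd e S; last by rewrite nbhd_max // in_set0.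
apply/nbhdP => z zS; have [zx|zx] := eqVneq z x; last by rewrite vx // !inE zx.
by rewrite vy // !inE zx xy.
Qed.

Lemma extremal_partition : (1 < p)%N ->
  (exists f : T -> 'I_p, triangle_free_partition e f)
  /\ (forall v, surplus e beta v = 0).
Proof.
move=> p1; have p0 := ltnW p1.
have [_ pb _] := pp_bounds beta0 beta1.
have [S SK] := cliques_exist eI eC beta0 beta1 mindeg n0 (leqnn p.+1).
have /cliquesP[cS kS] := SK.
have /card_geqP[s [us cs sH]] := card_heavy p0 SK.
have sS x : x \in s -> x \in S by move/sH; rewrite inE => /andP[].
have [x0 x0s] : exists x, x \in s.
  by case: s cs {us sH sS} => [/=|x s _]; [lia | exists x; rewrite mem_head].
pose W x := nbhd e (S :\ x).
(* The position of the first chosen facet whose common neighbourhood contains [v], or [p - 1] if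
   there is none. The shift in [c] reserves index 0 for the latter vertices, which form [V_0]. *)
pose k v := find (fun x => v \in W x) s.
pose c v := if (k v < p.-1)%N then (k v).+1 else 0%N.
have c_lt v : (c v < p)%N by rewrite /c; case: (ltnP (k v)); rewrite ?ltn_predRL.
pose f v := Ordinal (c_lt v).
have kW v x : x \in s -> v \in W x -> k v = index x s.
  move=> xs vx; have hv : has (fun x => v \in W x) s by apply/hasP; exists x.
  have ks : (k v < size s)%N by rewrite -has_find.
  have /= vk := nth_find x0 hv.
  rewrite -(extremal_disjoint SK (sS _ (mem_nth x0 ks)) (sS _ xs) vk vx).
  by rewrite index_uniq.
have fW v x : x \in s -> (v \in W x) = (f v == (index x s).+1 :> nat).
  move=> xs; have xi : (index x s < p.-1)%N by rewrite -cs index_mem.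
  apply/idP/eqP => [vx|] /=; rewrite /c.
    by rewrite (kW v x) // xi.
  case: (ltnP (k v)) => // kp [E].
  have hv : has (fun x => v \in W x) s by rewrite has_find cs.
  by have /= := nth_find x0 hv; rewrite -/(k v) E nth_index.
have classW (i : 'I_p) : (0 < i)%N -> exists2 x, x \in s & [set v | f v == i] = W x.
  move=> i0; have is_ : (i.-1 < size s)%N by rewrite cs; have := ltn_ord i; lia.
  exists (nth x0 s i.-1); first exact: mem_nth.
  apply/setP => v; rewrite [RHS](fW _ _ (mem_nth _ is_)) inE -val_eqE /=.
  by rewrite index_uniq // prednK.
have class_pos u : (0 < f u)%N -> exists2 x, x \in s & [set v | f v == f u] = W x.
  exact: classW.
have adj u v : (0 < f u)%N -> e u v = (f u != f v).
  move=> fu; have [x xs E] := class_pos u fu.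
  have uW : u \in W x by rewrite -E inE.
  by rewrite (extremal_class v SK (sH _ xs) uW) -/(W x) -E inE eq_sym.
have sizes (i : 'I_p) : (0 < i)%N -> #|[set v | f v == i]|%:R = beta * n.
  move=> i0; have [x xs ->] := classW i i0.
  by have := sH _ xs; rewrite inE => /andP[_ /eqP].
have s_pos x : x \in s -> (0 < f x)%N.
  move=> xs; have : x \in W x by have [] := cliques_setD1 SK (sS _ xs).
  by rewrite fW // => /eqP->.
have s_inj x y : x \in s -> y \in s -> f x = f y -> x = y.
  move=> xs ys E; have : x \in W x by have [] := cliques_setD1 SK (sS _ xs).
  have : y \in W y by have [] := cliques_setD1 SK (sS _ ys).
  by rewrite !fW // E => yW xW; apply: extremal_disjoint SK (sS _ xs) (sS _ ys) _ _;
    rewrite -/(W _) fW; eassumption.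
have cV0 : #|part0 f|%:R = (1 - (p.-1)%:R * beta) * n.
  have : #|T| = (#|part0 f| + \sum_(i : 'I_p | i != Ordinal p0) #|[set v | f v == i]|)%N.
    rewrite -[#|T|]sum1_card (partition_big f xpredT) //= (bigD1 (Ordinal p0)) //=.
        congr (_ + _)%N; last by apply: eq_bigr => i _; rewrite sum1dep_card.
    by rewrite sum1dep_card; apply: eq_card => v; rewrite !inE -val_eqE.
  move=> /(congr1 (fun k => k%:R : rat)); rewrite natrD natr_sum.
  rewrite (eq_bigr (fun=> beta * n)) => [|i]; last first.
    by rewrite -val_eqE /= -lt0n; apply: sizes.
  rewrite sumr_const cardC1 card_ord -mulr_natl; lra.
have sK : [set x in s] \in cliques e p.-1.
  apply/cliquesP; rewrite cardsE (card_uniqP us); split=> //.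
  by apply: clique_subset kS; apply/subsetP => x; rewrite inE; apply: sS.
(* The vertices of [s] all lie outside [V_0], hence are joined to every vertex of [V_0]. *)
have sN v : f v = 0%N :> nat -> v \in nbhd e [set x in s].
  move=> fv; apply/nbhdP => x; rewrite inE => xs; rewrite adj ?s_pos //.
  by apply/negP => /eqP E; have := s_pos _ xs; rewrite E fv.
(* Every vertex lies in some [(p+1)]-clique: outside [V_0] it replaces a vertex of [S]; in [V_0] it
   forms a [p]-clique with [s], which has a common neighbour because [p * beta < 1]. *)
have defs v : surplus e beta v = 0.
  case: (posnP (f v)) => fv; last first.
    have [x xs E] := class_pos v fv.
    have vW : v \in W x by rewrite -E inE.
    exact: extremal_surplus (extremal_facet SK (sS _ xs) vW) (setU11 _ _).
  have := cliques_setU1 eI eC sK (sN v fv); rewrite prednK // => vK.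
  have [N0|[u uN]] := set_0Vmem (nbhd e (v |: [set x in s])).
    have /cliquesP[cvK _] := vK.
    have := card_nbhd_ge mindeg (v |: [set x in s]).
    by rewrite cvK N0 cards0 pmulr_lle0 // subr_le0 leNgt pb.
  apply: extremal_surplus (cliques_setU1 eI eC vK uN) _.
  by rewrite !inE eqxx orbT.
split=> //; exists f; split; first split=> //.
- move=> u v uv; case: (posnP (f u)) => fu; last by rewrite adj.
  case: (posnP (f v)) => fv; last by rewrite eC adj // eq_sym.
  by case/eqP: uv; apply: ord_inj; rewrite fu fv.
- by move=> u v fu E; rewrite adj // E eqxx.
(* Subtract from the degree [(1 - beta) * n] the vertices outside [V_0], all adjacent to [v]. *)
- move=> v; rewrite inE => /eqP; rewrite -/(nat_of_ord (f v)) => fv.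
  have : #|[set u | e v u]|%:R = #|[set u in part0 f | e v u]|%:R + #|~: part0 f|%:R :> rat.
    rewrite -natrD -(cardsID (part0 f)); congr (_ + _)%N%:R.
      by apply: eq_card => u; rewrite !inE andbC.
    apply: eq_card => u; rewrite !inE; case: eqP => //= /eqP; rewrite -lt0n => fu.
    have {}fu : (0 < f u)%N by [].
    by rewrite eC adj //; apply: contraTneq fu => ->; rewrite fv.
  have := congr1 (fun k => k%:R : rat) (cardsC (part0 f)).
  have /eqP := defs v; rewrite subr_eq0 /vdeg natrD cV0 => /eqP->.
  have -> : p%:R = p.-1%:R + 1 :> rat by rewrite natr1 prednK.
  lra.
(* A triangle in [V_0] together with the [p - 1] vertices of [s] would be a [(p+2)]-clique. *)
apply/eqP; rewrite cards_eq0; apply/eqP/setP => A; rewrite in_set0.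
apply/negP; rewrite inE => /andP[/eqP cA kA].
have A0 x : x \in A -> f x = 0%N :> nat.
  move=> xA; have /set0Pn[y] : A :\ x != set0.
    by rewrite -cards_eq0; move: cA; rewrite (cardsD1 x) xA; lia.
  rewrite !inE => /andP[yx yA].
  by have := is_cliqueP _ _ kA _ _ yA xA yx; rewrite /induced !inE => /and3P[_ /eqP].
have : A :|: [set x in s] \in cliques e p.+2.
  apply/cliquesP; rewrite cardsU cA.
  have -> : A :&: [set x in s] = set0.
    apply/setP => x; rewrite !inE; apply/negP => /andP[/A0 E /s_pos]; by rewrite E.
  rewrite cards0 cardsE (card_uniqP us) cs; split; first lia.
  have /cliquesP[_ ks] := sK.
  apply/is_cliqueP => x y /setUP[xA|xs] /setUP[yA|ys] xy.
  - by have := is_cliqueP _ _ kA _ _ xA yA xy; case/and3P.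
  - by rewrite eC; apply: (nbhdP _ _ _ (sN _ (A0 _ xA))).
  - by apply: (nbhdP _ _ _ (sN _ (A0 _ yA))).
  - exact: is_cliqueP _ _ ks _ _ xs ys xy.
by rewrite cliques_pp2 // in_set0.
Qed.

End Extremal.

(** * Between partitions, the family and feasibility *)

Lemma family_part_relpre (U T : finType) (h : U -> T) (e : rel T) (beta : rat)
    (f : T -> 'I_(pp beta)) :
  bijective h -> family_part e beta f -> family_part (relpre h e) beta (f \o h).
Proof.
move=> hB; have hI := bij_inj hB; have [g hK gK] := hB.
have cU : #|U| = #|T| by apply: bij_eq_card hB.
have pre (P : pred T) : #|[set u | P (h u)]| = #|[set v | P v]|.
  rewrite -(card_imset _ hI); apply: eq_card => v; rewrite inE.
  apply/imsetP/idP => [[u + ->]|Pv]; first by rewrite inE.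
  by exists (g v); rewrite ?inE gK.
have c0 : #|part0 (f \o h)| = #|part0 f| by apply: (pre (fun v => f v == 0%N :> nat)).
move=> [[eI eC] [H0 [Hi [cross [indep [reg min]]]]]].
rewrite /family_part c0 cU; do !split=> //.
- by move=> u; apply: eI.
- by move=> u v; apply: eC.
- by move=> i i0; rewrite (pre (fun v => f v == i)) Hi.
- by move=> u v; apply: cross.
- by move=> u v; apply: indep.
- move=> v; rewrite inE => fv; have hv : h v \in part0 f by rewrite inE.
  rewrite -(reg _ hv); congr _%:R.
  rewrite -(pre (fun w => (w \in part0 f) && e (h v) w)).
  by apply: eq_card => u; rewrite !inE.
(* The pulled-back graph on [V_0] embeds into the original one, so it has no more triangles. *)
move=> e' se' re'; apply: leq_trans (min e' se' re').
apply: (kcl_inj_le hI) => x y; by rewrite /induced !inE.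
Qed.

(** [feasible] only speaks of graphs on ['I_n]: pull [e] back along [enum_val], read off
    triangle-freeness there, and return by the inverse. *)
Lemma feasible_partition (T : finType) (e : rel T) (beta : rat) :
  feasible #|T| beta -> in_family e beta ->
  exists f : T -> 'I_(pp beta), triangle_free_partition e f.
Proof.
move=> [_ feas] [_ [f fP]]; exists f.
have hB : bijective (@enum_val T T) by apply: enum_val_bij.
have [g hK gK] := hB.
have tf := feas _ _ (family_part_relpre hB fP).
have [_ [H0 [Hi [cross [indep [reg _]]]]]] := fP; split=> //.
apply/eqP; rewrite -leqn0 -[X in (_ <= X)%N]tf; apply: (kcl_inj_le (can_inj gK)) => x y.
by rewrite /induced !inE /= !gK.
Qed.

(** One triangle-free [V_0] makes the minimum triangle count 0, so every member of the family is
    triangle-free there. *)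
Lemma partition_feasible (T : finType) (e : rel T) (beta : rat)
    (f : T -> 'I_(pp beta)) :
  simple_graph e -> family_defined #|T| beta -> triangle_free_partition e f ->
  feasible #|T| beta /\ in_family e beta.
Proof.
move=> [eI eC] fd [[H0 Hi cross indep reg] tf].
split; last first.
  by split=> //; exists f; do !split=> //; rewrite tf.
split=> // e' f' [_ [H0' [_ [_ [_ [_ min]]]]]].
have E : #|part0 f'| = #|part0 f|.
  by apply/eqP; rewrite -(eqr_nat rat) H0' H0 card_ord.
apply/eqP; rewrite -leqn0 -[X in (_ <= X)%N]tf; move: min; rewrite E card_ord.
(* The graph on [V_0], re-indexed, competes in the minimality condition of [e']; the orders agree
   since [n] and [beta] determine them. *)
pose e0 : rel 'I_#|part0 f| := relpre enum_val (induced e (part0 f)).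
move/(_ e0); move=> min; apply: leq_trans (min _ _) _.
- by split=> x; [|move=> y]; rewrite /e0 /induced /= ?eI ?andbF // andbCA eC.
- move=> v; rewrite -(reg _ (enum_valP v)); congr _%:R.
  rewrite /vdeg -(card_imset _ enum_val_inj); apply: eq_card => u.
  apply/imsetP/idP => [[w + ->]|].
    by rewrite !inE /e0 /= /induced => /and3P[_ + ->]; rewrite inE => ->.
  rewrite inE => /andP[u0 evu]; exists (enum_rank_in u0 u); rewrite ?enum_rankK_in //.
  by rewrite inE /e0 /= /induced enum_rankK_in // u0 enum_valP.
by apply: (kcl_inj_le enum_val_inj).
Qed.

(** The witness is the common degree; its product with [n] is even by the handshake lemma. *)
Lemma regular_family_defined (T : finType) (e : rel T) (beta : rat) :
  simple_graph e -> (0 < #|T|)%N -> beta < 1 ->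
  (forall v, (vdeg e v)%:R = (1 - beta) * #|T|%:R) -> family_defined #|T| beta.
Proof.
move=> se T0 beta1 reg; split=> //; have /card_gt0P[v _] := T0.
exists (vdeg e v); split; last split=> //.
  by rewrite -(ltr_nat rat) reg mulr_gt0 ?subr_gt0 // ltr0n.
have := even_sum_vdeg se; rewrite (eq_bigr (fun=> vdeg e v)) => [|u _].
  by rewrite sum_nat_const oddM.
by apply/eqP; rewrite -(eqr_nat rat) !reg.
Qed.

(** * The inequality and its equality cases *)

Theorem mainTheorem6 (T : finType) (e : rel T) (beta : rat) :
  0 < beta -> beta < 1 ->
  simple_graph e ->
  kcl (pp beta + 2) e = 0%N ->
  (forall v : T, (1 - beta) * #|T|%:R <= (vdeg e v)%:R) ->
  (exists v : T, (vdeg e v)%:R = (1 - beta) * #|T|%:R) ->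
  (forall s t : nat, (2 <= t)%N -> (t < s)%N -> (s <= pp beta + 1)%N ->
     clq_ratio e beta t <= clq_ratio e beta s)
  /\
  ((2 <= pp beta)%N ->
     ((exists s t : nat, [/\ (2 <= t)%N, (t < s)%N, (s <= pp beta + 1)%N &
                            clq_ratio e beta s = clq_ratio e beta t])
      <-> (forall s t : nat, (2 <= t)%N -> (t < s)%N -> (s <= pp beta + 1)%N ->
            clq_ratio e beta s = clq_ratio e beta t))
     /\
     ((forall s t : nat, (2 <= t)%N -> (t < s)%N -> (s <= pp beta + 1)%N ->
            clq_ratio e beta s = clq_ratio e beta t)
      <-> (feasible #|T| beta /\ in_family e beta))).
Proof.
move=> b0 b1 [eI eC] free mindeg [v0 dv0].
have T0 : (0 < #|T|)%N by apply/card_gt0P; exists v0.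
have n0 : 0 < #|T|%:R :> rat by rewrite ltr0n.
rewrite !addn1; split=> [s t t2 ts sp|p2].
  exact: ratio_mono (ltnW ts) sp.
(* The equivalences follow from a cycle: equality for all pairs, for some pair, membership in the
   family, and back. *)
have all_ex : (forall s t : nat, (2 <= t)%N -> (t < s)%N -> (s <= (pp beta).+1)%N ->
      clq_ratio e beta s = clq_ratio e beta t) ->
    exists s t : nat, [/\ (2 <= t)%N, (t < s)%N, (s <= (pp beta).+1)%N &
      clq_ratio e beta s = clq_ratio e beta t].
  by move=> H; exists 3, 2; split=> //; apply: H.
have ex_fam : (exists s t : nat, [/\ (2 <= t)%N, (t < s)%N, (s <= (pp beta).+1)%N &
      clq_ratio e beta s = clq_ratio e beta t]) ->
    feasible #|T| beta /\ in_family e beta.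
  move=> [s [t [t2 ts sp Est]]].
  have X0 := ratio_eq_excess eI eC b0 b1 mindeg free n0 t2 ts sp Est.
  have [[f fP] reg] := extremal_partition eI eC b0 b1 mindeg free n0 X0 p2.
  apply: (partition_feasible _ _ fP) => //; apply: (regular_family_defined (e := e)) => // v.
  by have /eqP := reg v; rewrite subr_eq0 => /eqP.
have fam_all : feasible #|T| beta /\ in_family e beta ->
    forall s t : nat, (2 <= t)%N -> (t < s)%N -> (s <= (pp beta).+1)%N ->
      clq_ratio e beta s = clq_ratio e beta t.
  move=> [feas fam]; have [f fP] := feasible_partition feas fam.
  move=> s t; apply: excess_eq0_ratio => // r _ _; apply: (partition_excess eI eC _ _ fP).
  exact: ltnW.
split; split.
- by move/ex_fam/fam_all.
- exact: all_ex.
- by move/all_ex/ex_fam.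
- exact: fam_all.
Qed.
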